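(* Let $A$ be a real symmetric $n\times n$ matrix and $i\in[n]$. (a) If $i$ is a downer index of $A$, then $A$ has the $i$-SNIP if and only if $A$ has the SAP. (b) If $i$ is a neutral index of $A$ and $t$ is the unique real number such that $i$ is a downer index of $A+tE_{i,i}$, then $A$ has the $i$-SNIP if and only if $A+tE_{i,i}$ has the SAP. (c) If $i$ is an upper index of $A$, then $A$ has the $i$-SNIP if and only if $A(i)$ has the SAP.
   Context: $A(i)$ is $A$ with row and column $i$ deleted. Index $i$ is upper if $\operatorname{null}(A(i))=\operatorname{null}(A)+1$, neutral if $\operatorname{null}(A(i))=\operatorname{null}(A)$, and downer if $\operatorname{null}(A(i))=\operatorname{null}(A)-1$. For a neutral index there is exactly one real $t$ (necessarily nonzero) making $i$ a downer index of $A+tE_{i,i}$, where $E_{i,i}$ is the matrix unit. A symmetric $A$ has the strong Arnold property (SAP) if $X=O$ is the only real symmetric $X$ with $A\circ X=O$, $I\circ X=O$ and $AX=O$ ($\circ$ the entrywise product). $A$ has the $i$-SNIP if $X=O$ is the only real symmetric $X$ with $A\circ X=O$, $I\circ X=O$ and $(AX)(i,:]=O$, where $(AX)(i,:]$ is $AX$ with row $i$ deleted. *)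

(* Defs.v *)
From mathcomp Require Import all_boot all_order all_algebra.
From mathcomp Require Import reals.
Set Implicit Arguments.
Unset Strict Implicit.
Unset Printing Implicit Defensive.
Import GRing.Theory.
Local Open Scope ring_scope.

Section Defs.
Variable R : realType.

(* The columns of [cokermx A] span {x | A x = 0}, so its rank is the dimension
   of the null space of A. *)
Definition nullity (m n : nat) (A : 'M[R]_(m, n)) : nat := \rank (cokermx A).

Definition principal_del (n : nat) (A : 'M[R]_n) (i : 'I_n) : 'M[R]_n.-1 :=
  row' i (col' i A).

Definition upper_index (n : nat) (A : 'M[R]_n) (i : 'I_n) : Prop :=
  nullity (principal_del A i) = (nullity A + 1)%N.

Definition neutral_index (n : nat) (A : 'M[R]_n) (i : 'I_n) : Prop :=
  nullity (principal_del A i) = nullity A.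

(* null(A(i)) = null(A) - 1, written so as to avoid truncated subtraction:
   null(A) = null(A(i)) = 0 must not count as downer. *)
Definition downer_index (n : nat) (A : 'M[R]_n) (i : 'I_n) : Prop :=
  (nullity (principal_del A i) + 1)%N = nullity A.

Definition hadamard (m n : nat) (A B : 'M[R]_(m, n)) : 'M[R]_(m, n) :=
  map2_mx *%R A B.

Definition SAP (n : nat) (A : 'M[R]_n) : Prop :=
  forall X : 'M[R]_n, X^T = X ->
    hadamard A X = 0 -> hadamard 1%:M X = 0 -> A *m X = 0 -> X = 0.

Definition SNIP (n : nat) (A : 'M[R]_n) (i : 'I_n) : Prop :=
  forall X : 'M[R]_n, X^T = X ->
    hadamard A X = 0 -> hadamard 1%:M X = 0 -> row' i (A *m X) = 0 -> X = 0.

End Defs.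

(* Main.v *)
Require Import Defs.
From mathcomp Require Import all_boot all_order all_algebra.
From mathcomp Require Import reals zify.
Set Implicit Arguments.
Unset Strict Implicit.
Unset Printing Implicit Defensive.
Import GRing.Theory.
Local Open Scope ring_scope.

(** Deleting row [i] from [A X] loses nothing when row [i] of [A] is a
    combination of the other rows, and a rank count shows that this is the case
    at a downer index; hence (a).  Since [X] has zero diagonal, neither
    [A o X = O] nor the rows of [A X] other than row [i] see the entry [A i i],
    so (b) reduces to (a).  At an upper index the rank count yields a vector [z]
    with [z A(i) = 0] whose product with the rest of column [i] is nonzero;
    multiplying [(A X)(i,:] = O] by [z] on the left kills row [i] of [X], and
    what is left of [X] is a test matrix for the SAP of [A(i)]. *)

Section RowDeletion.
Variable F : fieldType.

Lemma row'_mul m n p (i : 'I_m) (A : 'M[F]_(m, n)) (B : 'M[F]_(n, p)) :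
  row' i (A *m B) = row' i A *m B.
Proof. by rewrite row'Esub mul_rowsub_mx. Qed.

Lemma row'_submx m n (i : 'I_m) (A : 'M[F]_(m, n)) : (row' i A <= A)%MS.
Proof. by rewrite row'Esub rowsub_sub. Qed.

Lemma mxrank_col'_leq m n (j : 'I_n) (A : 'M[F]_(m, n)) :
  (\rank (col' j A) <= \rank A)%N.
Proof.
by rewrite -(mxrank_tr A) -mxrank_tr tr_col' mxrankS // row'_submx.
Qed.

(** Row [i] and the remaining rows together span the row space, and a single row adds at most one to
    the rank. *)
Lemma mxrank_row'_geq m n (i : 'I_m) (A : 'M[F]_(m, n)) :
  (\rank A <= (\rank (row' i A)).+1)%N.
Proof.
have sA : (A <= row i A + row' i A)%MS.
  apply/row_subP => j; case: (unliftP i j) => [k|] ->; last exact: addsmxSl.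
  apply: submx_trans (addsmxSr _ _).
  have -> : row (lift i k) A = row k (row' i A) by apply/rowP=> l; rewrite !mxE.
  exact: row_sub.
apply: leq_trans (mxrankS sA) _.
apply: leq_trans (mxrank_adds_leqif _ _) _.
by rewrite -[leqRHS]add1n leq_add2r rank_leq_row.
Qed.

End RowDeletion.

Section IndexTypes.
Variable R : realType.

Lemma hadamard0P m n (A B : 'M[R]_(m, n)) :
  hadamard A B = 0 <-> forall i j, A i j * B i j = 0.
Proof.
split=> [/matrixP h i j | h]; first by have := h i j; rewrite !mxE.
by apply/matrixP=> i j; rewrite !mxE.
Qed.

Lemma hadamard1P n (X : 'M[R]_n) :
  hadamard 1%:M X = 0 <-> forall j, X j j = 0.
Proof.
rewrite hadamard0P; split=> [h j | h j k].
  by have := h j j; rewrite mxE eqxx mul1r.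
by rewrite mxE; case: eqP => [->|_]; rewrite ?mul0r // h mulr0.
Qed.

Lemma SNIP_SAP n (A : 'M[R]_n) i : SNIP A i -> SAP A.
Proof.
by move=> snA X symX AX IX AX0; apply: snA => //; rewrite AX0 linear0.
Qed.

(** Size and nullity both drop by one, so [A] and [A(i)] have equal rank. As [A(i)] arises from
    [row' i A] by deleting a column, [row' i A] already has the rank of [A], hence its row space. *)
Lemma downer_submx n (A : 'M[R]_n) i :
  downer_index A i -> (A <= row' i A)%MS.
Proof.
rewrite /downer_index /nullity !mxrank_coker => dA.
rewrite -(geq_leqif (mxrank_leqif_sup (row'_submx i A))).
have -> : \rank A = \rank (principal_del A i).
  (* Nullities are truncated differences of naturals, so the rank bounds and [0 < n] are needed to
     cancel. *)
  have := rank_leq_row A; have := rank_leq_row (principal_del A i).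
  by have := ltn_ord i; lia.
have -> : principal_del A i = col' i (row' i A).
  by apply/matrixP=> j k; rewrite !mxE.
exact: mxrank_col'_leq.
Qed.

Lemma downer_SNIP_SAP n (A : 'M[R]_n) i :
  downer_index A i -> (SNIP A i <-> SAP A).
Proof.
move=> /downer_submx/submxP[U defA]; split=> [|sapA X symX AX IX rAX0].
  exact: SNIP_SAP.
by apply: sapA => //; rewrite defA -mulmxA -row'_mul rAX0 mulmx0.
Qed.

Lemma SNIP_shift n (A : 'M[R]_n) i t :
  SNIP A i <-> SNIP (A + t *: delta_mx i i) i.
Proof.
suff shift (B : 'M[R]_n) (s : R) : SNIP B i -> SNIP (B + s *: delta_mx i i) i.
  split=> [|/(shift _ (- t))]; first exact: shift.
  by rewrite scaleNr addrK.
move=> snB X symX /hadamard0P BX IX rBX0; apply: snB => //.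
  move/hadamard1P: IX => IX; apply/hadamard0P => j k.
  have := BX j k; rewrite !mxE.
  have [->|_] := eqVneq j i; have [->|_] := eqVneq k i => /=;
    by rewrite ?IX ?mulr0 ?addr0.
(* [delta_mx i i] is supported in row [i], the row that is deleted. *)
rewrite -rBX0 !row'_mul; congr (_ *m _); apply/matrixP=> j k.
by rewrite !mxE eq_sym (negPf (neq_lift i j)) mulr0 addr0.
Qed.

Lemma upper_witness n (A : 'M[R]_n) i : upper_index A i ->
  exists z : 'rV_n.-1,
    z *m principal_del A i = 0 /\ (z *m row' i A) 0 i != 0.
Proof.
rewrite /upper_index /nullity !mxrank_coker => uA.
(* Here [A] has rank two more than [A(i)], and deleting row [i] costs at most one. *)
have ltr : (\rank (principal_del A i) < \rank (row' i A))%N.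
  rewrite -ltnS; apply: leq_trans (mxrank_row'_geq i A).
  have := rank_leq_row A; have := rank_leq_row (principal_del A i).
  by have := ltn_ord i; lia.
(* Both matrices have [n.-1] rows, so the one of smaller rank has the larger left kernel. *)
have /row_subPn[j nker] :
    ~~ (kermx (principal_del A i) <= kermx (row' i A))%MS.
  apply: contraTN ltr => /mxrankS; rewrite !mxrank_ker -leqNgt.
  by have := rank_leq_row (row' i A); lia.
pose z := row j (kermx (principal_del A i)).
have zB : z *m principal_del A i = 0 by apply/sub_kermxP/row_sub.
(* Away from column [i], the columns of [row' i A] are those of [A(i)], which [z] kills; a zero at
   [i] would put [z] in the smaller kernel. *)
exists z; split=> //; apply: contra nker => /eqP zi0.
apply/sub_kermxP/rowP => k; rewrite -/z [RHS]mxE.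
case: (unliftP i k) => [l|] -> //.
move/rowP: zB => /(_ l); rewrite !mxE => zB; rewrite -[RHS]zB.
by apply: eq_bigr => m _; rewrite !mxE.
Qed.

Lemma row'_mul_principal_del n (A X : 'M[R]_n) i :
  (forall k, X i k = 0) -> (forall k, X k i = 0) ->
  row' i (A *m X) = 0 <-> principal_del A i *m principal_del X i = 0.
Proof.
move=> Xi0 X0i.
have E j k : (principal_del A i *m principal_del X i) j k =
             row' i (A *m X) j (lift i k).
  rewrite !mxE (bigD1_ord i) //= Xi0 mulr0 add0r.
  by apply: eq_bigr => l _; rewrite !mxE.
split=> [r0 | B0]; first by apply/matrixP=> j k; rewrite E r0 !mxE.
apply/matrixP=> j k; case: (unliftP i k) => [l|] ->.
  by rewrite -E B0 !mxE.
by rewrite !mxE big1 // => l _; rewrite X0i mulr0.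
Qed.

(** Turns a test matrix for the SAP of [A(i)] into one for the [i]-SNIP of [A]. *)
Definition zero_border n (i : 'I_n) (Y : 'M[R]_n.-1) : 'M[R]_n :=
  \matrix_(j, k) if unlift i j is Some j' then
                   if unlift i k is Some k' then Y j' k' else 0
                 else 0.

Lemma zero_borderK n (i : 'I_n) Y : principal_del (zero_border i Y) i = Y.
Proof. by apply/matrixP=> j k; rewrite !mxE !liftK. Qed.

Lemma SNIP_SAP_principal_del n (A : 'M[R]_n) i :
  SNIP A i -> SAP (principal_del A i).
Proof.
move=> snA Y symY /hadamard0P AY /hadamard1P IY BY0.
rewrite -(zero_borderK i Y); suff -> : zero_border i Y = 0.
  by apply/matrixP=> j k; rewrite !mxE.
apply: snA.
- apply/matrixP=> j k; rewrite !mxE.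
  case: (unlift i j) => [j'|]; case: (unlift i k) => [k'|] //.
  by rewrite -[in LHS]symY mxE.
- apply/hadamard0P=> j k; rewrite mxE.
  case: (unliftP i j) => [j'|] ->; last by rewrite mulr0.
  case: (unliftP i k) => [k'|] ->; last by rewrite mulr0.
  by have := AY j' k'; rewrite !mxE.
- by apply/hadamard1P=> j; rewrite mxE; case: (unlift i j) => [j'|].
- apply/row'_mul_principal_del; rewrite ?zero_borderK // => k;
    rewrite mxE unlift_none //.
  by case: (unlift i k).
Qed.

Lemma upper_SNIP_SAP n (A : 'M[R]_n) i :
  upper_index A i -> (SNIP A i <-> SAP (principal_del A i)).
Proof.
move=> /upper_witness[z [zB zi]].
split=> [|sapB X symX /hadamard0P AX /hadamard1P IX rAX0].
  exact: SNIP_SAP_principal_del.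
have Xi0 k : X i k = 0.
  (* The row [z *m row' i A] is supported at [i] alone, so its product with [X] is a nonzero
     multiple of row [i] of [X]. *)
  have /rowP/(_ k) : z *m row' i A *m X = 0.
    by rewrite -mulmxA -row'_mul rAX0 mulmx0.
  rewrite mxE (bigD1_ord i) //= big1 => [|l _].
    by rewrite addr0 [RHS]mxE => /eqP; rewrite mulf_eq0 (negPf zi) => /eqP.
  have -> : (z *m row' i A) 0 (lift i l) = (z *m principal_del A i) 0 l.
    by rewrite !mxE; apply: eq_bigr => m _; rewrite !mxE.
  by rewrite zB mxE mul0r.
have X0i k : X k i = 0 by rewrite -symX mxE.
have Y0 : principal_del X i = 0.
  apply: sapB; last exact/row'_mul_principal_del.
  - by apply/matrixP=> j k; rewrite !mxE -[in LHS]symX mxE.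
  - by apply/hadamard0P=> j k; rewrite !mxE.
  - by apply/hadamard1P=> j; rewrite !mxE.
apply/matrixP=> j k; rewrite [RHS]mxE.
case: (unliftP i j) => [j'|] -> //; case: (unliftP i k) => [k'|] -> //.
by move/matrixP: Y0 => /(_ j' k'); rewrite !mxE.
Qed.

End IndexTypes.

Theorem theorem3p9 (R : realType) (n : nat) (A : 'M[R]_n) (i : 'I_n)
    (Asym : A^T = A) :
  [/\ downer_index A i -> (SNIP A i <-> SAP A),
      neutral_index A i ->
        forall t : R,
          unique (fun s : R => downer_index (A + s *: delta_mx i i) i) t ->
          (SNIP A i <-> SAP (A + t *: delta_mx i i))
    & upper_index A i -> (SNIP A i <-> SAP (principal_del A i))].
Proof.
split; [exact: downer_SNIP_SAP | move=> _ t [dt _] | exact: upper_SNIP_SAP].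
by apply: iff_trans (SNIP_shift A i t) _; apply: downer_SNIP_SAP.
Qed.
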